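(* Let $D\subset\mathbb{R}^m$ be a nonempty bounded polyhedron with extreme points $z^i$, $i\in I=\{1,\dots,n\}$, and let $f:\mathbb{R}^m\to\mathbb{R}$ be continuously differentiable on $D$. Let the method (PVM) described in the context be applied, with arbitrary admissible parameters, starting point and choices. Then: (i) the number of changes of the index $k$ at each stage $l$ is finite (so that every stage terminates and the method generates an infinite sequence $\{w^l\}$); (ii) the sequence $\{w^l\}$ has limit points, and every limit point $x^*$ of $\{w^l\}$ is a solution of the variational inequality: $x^*\in D$ and $\langle f'(x^* ),x-x^*\rangle\ge 0$ for all $x\in D$; (iii) if $f$ is convex, then $\lim_{l\to\infty} f(w^l)=f^*$, and all the limit points of $\{w^l\}$ belong to $D^*$.
   Context: Notation: $\langle\cdot,\cdot\rangle$ is the usual scalar product, $f'(x)$ is the gradient of $f$ at $x$, $f^*=\inf_{x\in D}f(x)$, and $D^*$ is the set of minimizers of $f$ over $D$. $\mathbb{Z}_+$ is the set of non-negative integers. Weight vectors: since $D$ is the convex hull of its extreme points $z^1,\dots,z^n$, each $x\in D$ has at least one (in general non-unique) associated weight vector $u=u(x)\in\mathbb{R}^n$ with $x=\sum_{i\in I}u_iz^i$, $\sum_{i\in I}u_i=1$, $u_i\ge 0$ for $i\in I$. Given $\varepsilon>0$ and a weight vector $u(x)$ of $x$, set $I_\varepsilon(x)=\{i\in I: u_i(x)\ge\varepsilon\}$ (this set depends on the weight vector chosen). Method (PVM). Initialization: choose $w^0\in D$, numbers $\beta\in(0,1)$, $\theta\in(0,1)$, and sequences of positive numbers $\{\delta_l\}$,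 $\{\varepsilon_l\}$ decreasing to $0$, with $\varepsilon_0\in(0,1)$. Set $l:=1$. Step 0: set $k:=0$, $x^0:=w^{l-1}$. Step 1: take some weight vector $u^k=u(x^k)$ associated with $x^k$ (any one). If there are $i\in I_{\varepsilon_l}(x^k)$ (defined with $u^k$) and $j\in I$ such that $\langle f'(x^k),z^i-z^j\rangle\ge\delta_l$, choose such a pair, choose $\gamma_k\in[\varepsilon_l,u^k_i]$, set $i_k:=i$, $j_k:=j$ and go to Step 2. Otherwise (no pair $i\in I_{\varepsilon_l}(x^k)$, $j\in I$ satisfies this inequality) set $w^l:=x^k$, $l:=l+1$ and go to Step 0 (restart). Step 2: set $d^k:=z^{j_k}-z^{i_k}$, determine $m_k$ as the smallest number in $\mathbb{Z}_+$ such that $$f(x^k+\theta^{m_k}\gamma_kd^k)\le f(x^k)+\beta\theta^{m_k}\gamma_k\langle f'(x^k),d^k\rangle,$$ set $\lambda_k:=\theta^{m_k}\gamma_k$, $x^{k+1}:=x^k+\lambda_kd^k$, $k:=k+1$ and go to Step 1. Stage $l$ is the run of inner iterations (in $k$) performed with the fixed tolerances $\delta_l,\varepsilon_l$. *)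

(* Defs.v *)
From mathcomp Require Import all_boot all_order all_algebra.
From mathcomp Require Import all_classical all_reals all_analysis.
Set Implicit Arguments.
Unset Strict Implicit.
Unset Printing Implicit Defensive.
Import Order.TTheory GRing.Theory Num.Theory.
Import numFieldNormedType.Exports.
Local Open Scope classical_set_scope.
Local Open Scope ring_scope.

Definition dot (R : realType) (m : nat) (x y : 'rV[R]_m) : R :=
  \sum_(i < m) x ord0 i * y ord0 i.

Definition gradient (R : realType) (m : nat) (f : 'rV[R]_m -> R^o)
    (x : 'rV[R]_m) : 'rV[R]_m :=
  \row_(i < m) 'D_(delta_mx ord0 i) f x.

(* Points of D may lie on its boundary: f is differentiable there as a function
   on the whole space, while continuity of the gradient is only relative to D. *)
Definition continuously_differentiable_on (R : realType) (m : nat)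
    (D : set 'rV[R]_m) (f : 'rV[R]_m -> R^o) : Prop :=
  (forall x, D x -> differentiable f x) /\ {within D, continuous (gradient f)}.

Definition polyhedron (R : realType) (m : nat) (D : set 'rV[R]_m) : Prop :=
  exists (q : nat) (a : 'I_q -> 'rV[R]_m) (b : 'I_q -> R),
    D = [set x | forall i, dot (a i) x <= b i].

Definition extreme_points (R : realType) (m : nat) (D : set 'rV[R]_m) :
    set 'rV[R]_m :=
  [set x | D x /\ forall (y y' : 'rV[R]_m) (t : R),
     D y -> D y' -> 0 < t < 1 -> x = t *: y + (1 - t) *: y' -> y = y'].

Definition minimizers (R : realType) (m : nat) (D : set 'rV[R]_m)
    (f : 'rV[R]_m -> R^o) : set 'rV[R]_m :=
  [set x | D x /\ forall y, D y -> f x <= f y].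

Definition VI_solution (R : realType) (m : nat) (D : set 'rV[R]_m)
    (F : 'rV[R]_m -> 'rV[R]_m) (x : 'rV[R]_m) : Prop :=
  D x /\ forall y, D y -> 0 <= dot (F x) (y - x).

Definition weight_vector (R : realType) (m n : nat) (z : 'I_n -> 'rV[R]_m)
    (x : 'rV[R]_m) (u : 'rV[R]_n) : Prop :=
  [/\ x = \sum_(i < n) u ord0 i *: z i,
      \sum_(i < n) u ord0 i = 1
    & forall i, 0 <= u ord0 i].

Definition active_indices (R : realType) (n : nat) (e : R) (u : 'rV[R]_n) :
    {set 'I_n} :=
  [set i | e <= u ord0 i]%SET.

Record PVM_params (R : realType) := PVMParams {
  beta : R;
  theta : R;
  delta : nat -> R;
  eps : nat -> R
}.

Definition admissible_params (R : realType) (p : PVM_params R) : Prop :=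
  [/\ 0 < beta p < 1,
      0 < theta p < 1,
      [/\ forall l, 0 < delta p l, nonincreasing_seq (delta p)
        & delta p @ \oo --> (0 : R)],
      [/\ forall l, 0 < eps p l, nonincreasing_seq (eps p)
        & eps p @ \oo --> (0 : R)]
    & eps p 0%N < 1].

(* Program points of the method together with the current values of its
   variables. [Step0 l w] is the (re)start of stage l, with w = w^(l-1). *)
Inductive PVM_state (R : realType) (m n : nat) :=
| Step0 of nat & 'rV[R]_m
| Step1 of nat & nat & 'rV[R]_m
| Step2 of nat & nat & 'rV[R]_m & 'I_n & 'I_n & R.
Arguments Step0 {R m n}.
Arguments Step1 {R m n}.
Arguments Step2 {R m n}.

(* In stage l, the pair (i, j) is eligible at x for the chosen weights u. *)
Definition eligible_pair (R : realType) (m n : nat) (z : 'I_n -> 'rV[R]_m)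
    (f : 'rV[R]_m -> R^o) (p : PVM_params R) (l : nat) (x : 'rV[R]_m)
    (u : 'rV[R]_n) (i j : 'I_n) : Prop :=
  i \in active_indices (eps p l) u /\
  delta p l <= dot (gradient f x) (z i - z j).

Definition sufficient_descent (R : realType) (m : nat) (f : 'rV[R]_m -> R^o)
    (p : PVM_params R) (x d : 'rV[R]_m) (g : R) (q : nat) : Prop :=
  f (x + (theta p ^+ q * g) *: d) <=
    f x + beta p * (theta p ^+ q * g) * dot (gradient f x) d.

Inductive PVM_next (R : realType) (m n : nat) (z : 'I_n -> 'rV[R]_m)
    (f : 'rV[R]_m -> R^o) (p : PVM_params R) :
    PVM_state R m n -> PVM_state R m n -> Prop :=
| PVM_start l w :
    PVM_next z f p (Step0 l w) (Step1 l 0 w)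
| PVM_select l k x u i j g :
    weight_vector z x u ->
    eligible_pair z f p l x u i j ->
    eps p l <= g <= u ord0 i ->
    PVM_next z f p (Step1 l k x) (Step2 l k x i j g)
| PVM_restart l k x u :
    weight_vector z x u ->
    (forall i j, ~ eligible_pair z f p l x u i j) ->
    PVM_next z f p (Step1 l k x) (Step0 l.+1 x)
| PVM_linesearch l k x i j g q :
    sufficient_descent f p x (z j - z i) g q ->
    (forall q', (q' < q)%N -> ~ sufficient_descent f p x (z j - z i) g q') ->
    PVM_next z f p (Step2 l k x i j g)
      (Step1 l k.+1 (x + (theta p ^+ q * g) *: (z j - z i))).

Inductive PVM_reachable (R : realType) (m n : nat) (z : 'I_n -> 'rV[R]_m)
    (f : 'rV[R]_m -> R^o) (p : PVM_params R) (w0 : 'rV[R]_m) :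
    PVM_state R m n -> Prop :=
| PVM_reach_init : PVM_reachable z f p w0 (Step0 1 w0)
| PVM_reach_next s s' :
    PVM_reachable z f p w0 s -> PVM_next z f p s s' ->
    PVM_reachable z f p w0 s'.

Definition PVM_run (R : realType) (m n : nat) (z : 'I_n -> 'rV[R]_m)
    (f : 'rV[R]_m -> R^o) (p : PVM_params R) (w0 : 'rV[R]_m)
    (s : nat -> PVM_state R m n) : Prop :=
  s 0%N = Step0 1 w0 /\ forall t, PVM_next z f p (s t) (s t.+1).

(* Times at which the run s changes the index k during stage l; the change
   k := k+1 happens exactly when Step 2 is executed. *)
Definition k_changes (R : realType) (m n : nat) (s : nat -> PVM_state R m n)
    (l : nat) : set nat :=
  [set t | exists k x i j g, s t = Step2 l k x i j g].

(* w^l is the point with which stage l+1 is started. *)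
Definition generates (R : realType) (m n : nat) (s : nat -> PVM_state R m n)
    (w : nat -> 'rV[R]_m) : Prop :=
  forall l, exists t, s t = Step0 l.+1 (w l).

(* Main.v *)
Require Import Defs.
From mathcomp Require Import all_boot all_order all_algebra.
From mathcomp Require Import all_classical all_reals all_analysis.
From mathcomp Require Import ring lra.
Import Order.TTheory GRing.Theory Num.Theory.
Import numFieldNormedType.Exports.
Local Open Scope classical_set_scope.
Local Open Scope ring_scope.
Set Implicit Arguments.
Unset Strict Implicit.
Unset Printing Implicit Defensive.

(** The bounded polyhedron D is the convex hull of its extreme points
    ([polytope_weights], the finite-dimensional Krein-Milman theorem). This makes
    the method executable, since every point of D has weights, and it makes D
    compact, so that the gradient is bounded and uniformly continuous on D.

    Finiteness of a stage. By the mean value theorem and the uniform continuity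
    of the gradient, there is a step length tau, depending only on the stage,
    such that every step of length at most tau along an edge direction of slope
    at most -delta_l passes the Armijo test ([uniform_descent]). The backtracking
    therefore stops, and it stops with a step at least
    min(eps_l, theta * tau), so that each iteration of stage l decreases f by at
    least a fixed positive amount ([line_search_decrease]). As f never increases
    along a run and is bounded on D, only finitely many iterations fit in a stage
    ([searching_eventually_stops]); a stage that never restarted would iterate
    for ever.

    Limit behaviour. When stage l stops at x with weights u, each vertex z_i
    satisfies <f'(x), z_i - z_j> < delta_l for all j, or has weight
    u_i < eps_l. Averaging these inequalities over i with the weights of x, then
    over j with the weights of an arbitrary y in D, gives
      <f'(x), x - y> <= delta_l + G eps_l
    with G independent of l, x and y ([stationary_gap]). The right-hand side
    tends to 0. Continuity of the gradient turns the inequality into the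
    variational inequality at every limit point ([cluster_VI_solution]), and
    compactness provides limit points. If f is convex, the gradient inequality
    turns the same bound into f(w^l) - f(y) <= delta_l + G eps_l for all y in D,
    hence f(w^l) tends to the infimum ([convex_values_cvg]). *)

(** * The scalar product *)

Section Dot.
Variables (R : realType) (m : nat).
Implicit Types (x y v : 'rV[R]_m) (c : R).

Lemma dotDr x y v : dot x (y + v) = dot x y + dot x v.
Proof. by rewrite /dot -big_split; apply: eq_bigr => i _; rewrite mxE mulrDr. Qed.

Lemma dotZr x c y : dot x (c *: y) = c * dot x y.
Proof. by rewrite /dot mulr_sumr; apply: eq_bigr => i _; rewrite mxE mulrCA. Qed.

Lemma dotNr x y : dot x (- y) = - dot x y.
Proof. by rewrite -scaleN1r dotZr mulN1r. Qed.

Lemma dotBr x y v : dot x (y - v) = dot x y - dot x v.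
Proof. by rewrite dotDr dotNr. Qed.

Lemma dot_sumr n x (u : 'I_n -> R) (v : 'I_n -> 'rV[R]_m) :
  dot x (\sum_(i < n) u i *: v i) = \sum_(i < n) u i * dot x (v i).
Proof.
rewrite {1}/dot; under eq_bigr => k _ do rewrite summxE mulr_sumr.
rewrite exchange_big; apply: eq_bigr => i _; rewrite /dot mulr_sumr.
by apply: eq_bigr => k _; rewrite mxE mulrCA.
Qed.

Lemma dotBl x y v : dot (x - y) v = dot x v - dot y v.
Proof.
by rewrite /dot -sumrB; apply: eq_bigr => i _; rewrite !mxE mulrBl.
Qed.

Lemma coord_le_norm x i : `|x ord0 i| <= `|x|.
Proof. by rewrite -[`|x|]/(mx_norm x) mx_normrE (le_bigmax _ (fun k => `|x k.1 k.2|) (ord0, i)). Qed.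

Lemma norm_dot_le x y : `|dot x y| <= m%:R * `|x| * `|y|.
Proof.
rewrite (le_trans (ler_norm_sum _ _ _))//.
have -> : m%:R * `|x| * `|y| = \sum_(i < m) `|x| * `|y|.
  by rewrite sumr_const card_ord -mulrA mulr_natl.
rewrite ler_sum// => i _.
by rewrite normrM ler_pM// coord_le_norm.
Qed.

Lemma dot_cvg (T : Type) (F : set_system T) (FF : Filter F)
    (u v : T -> 'rV[R]_m) (a b : 'rV[R]_m) :
  u @ F --> a -> v @ F --> b -> dot (u t) (v t) @[t --> F] --> dot a b.
Proof.
move=> ua vb; apply: cvg_big => [|i _]; first exact: add_continuous.
apply: cvgM.
  exact: (cvg_comp _ _ ua (@coord_continuous _ _ _ ord0 i a)).
exact: (cvg_comp _ _ vb (@coord_continuous _ _ _ ord0 i b)).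
Qed.

Lemma dot_continuous_r x : continuous (dot x).
Proof.
by move=> y; exact: (@dot_cvg _ (nbhs y) _ _ id _ _ (cvg_cst x) cvg_id).
Qed.

End Dot.

(** * Weight vectors *)

Section Weights.
Variables (R : realType) (m n : nat) (z : 'I_n -> 'rV[R]_m).

Lemma weight_vector_vertex i : weight_vector z (z i) (delta_mx ord0 i).
Proof.
split.
- rewrite (bigD1 i)//= big1 ?addr0 => [|j ji]; first by rewrite mxE !eqxx scale1r.
  by rewrite mxE (negbTE ji) andbF scale0r.
- rewrite (bigD1 i)//= big1 ?addr0 => [|j ji]; first by rewrite mxE !eqxx.
  by rewrite mxE (negbTE ji) andbF.
- by move=> j; rewrite mxE ler0n.
Qed.

Lemma weight_vector_conv x y u v (t : R) : 0 <= t <= 1 ->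
  weight_vector z x u -> weight_vector z y v ->
  weight_vector z (t *: x + (1 - t) *: y) (t *: u + (1 - t) *: v).
Proof.
move=> /andP[t0 t1] [-> su u0] [-> sv v0]; split.
- rewrite !scaler_sumr -big_split; apply: eq_bigr => i _ /=.
  by rewrite !mxE !scalerA -scalerDl.
- under eq_bigr => i _ do rewrite !mxE.
  rewrite big_split -!mulr_sumr su sv /=; ring.
- by move=> i; rewrite !mxE addr_ge0// mulr_ge0// subr_ge0.
Qed.

(** Moving along z_j - z_i transfers weight from z_i to z_j: this is why a step
    bounded by the weight of z_i stays in the convex hull. *)
Lemma weight_vector_shift x u i j (t : R) : weight_vector z x u ->
  0 <= t <= u ord0 i ->
  weight_vector z (x + t *: (z j - z i))
    (u + t *: (delta_mx ord0 j - delta_mx ord0 i)).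
Proof.
move=> [-> su u0] /andP[t0 tu].
have [zi si _] := weight_vector_vertex i.
have [zj sj _] := weight_vector_vertex j.
split.
- rewrite {1}zi {1}zj -sumrB scaler_sumr -big_split; apply: eq_bigr => k _ /=.
  by rewrite !mxE !scalerDl -scalerA scalerBl.
- under eq_bigr => k _ do rewrite mxE [X in _ + X]mxE mxE [X in _ * (_ + X)]mxE.
  rewrite big_split -mulr_sumr /=.
  by rewrite sumrB si sj subrr mulr0 addr0.
- move=> k; rewrite !mxE eqxx /=; have := u0 k; have := u0 i.
  by case: (eqVneq k i) => [->|_]; case: (eqVneq _ j) => _ /=; lra.
Qed.

Lemma dot_weight_vector x u (g y : 'rV[R]_m) : weight_vector z x u ->
  dot g (x - y) = \sum_(i < n) u ord0 i * dot g (z i - y).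
Proof.
move=> [-> su _]; rewrite dotBr dot_sumr.
under [RHS]eq_bigr => i _ do rewrite dotBr mulrBr.
by rewrite sumrB -mulr_suml su mul1r.
Qed.

End Weights.

(** * Bounded polyhedra are convex hulls of their extreme points *)

Section Polytope.
Variables (R : realType) (m q : nat) (a : 'I_q -> 'rV[R]_m) (b : 'I_q -> R).
Let P := [set x : 'rV[R]_m | forall i, dot (a i) x <= b i].
Hypothesis P_bounded : bounded_set P.

Definition slack (x : 'rV[R]_m) := [set i | dot (a i) x < b i]%SET.

(** A direction that is orthogonal to the constraints tight at x can be followed
    until a new constraint becomes tight, which must happen since P is bounded.
    The point reached lies on a face of smaller dimension; [slack] is the
    measure for the induction in [polytope_weights]. *)
Lemma polytope_face_exit x d : P x -> d != 0 ->
  (forall i, dot (a i) x = b i -> dot (a i) d = 0) ->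
  exists s, [/\ 0 < s, P (x + s *: d) & (#|slack (x + s *: d)| < #|slack x|)%N].
Proof.
move=> Px d0 tight.
have [i0 pos_i0] : exists i, 0 < dot (a i) d.
  apply: contrapT => npos.
  have [M [_ /(_ (M + 1))]] := P_bounded; rewrite ltrDl ltr01 => /(_ isT) Pb.
  have nd : 0 < `|d| by rewrite normr_gt0.
  pose s := (`|M + 1| + `|x| + 1) / `|d|.
  have s0 : 0 <= s by rewrite divr_ge0// !addr_ge0.
  have /Pb : P (x + s *: d).
    move=> i; rewrite dotDr dotZr (le_trans _ (Px i))// gerDl mulr_ge0_le0//.
    by rewrite leNgt; apply/negP => ?; apply: npos; exists i.
  have sd : `|s *: d| = `|M + 1| + `|x| + 1.
    by rewrite normrZ (ger0_norm s0) divfK ?gt_eqF.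
  have := lerB_normD (s *: d) x; rewrite (addrC (s *: d)) sd /=.
  by have := ler_norm (M + 1); lra.
(* F i is the step at which constraint i becomes tight. *)
pose F i := (b i - dot (a i) x) / dot (a i) d.
case: (@Order.TotalTheory.arg_minP _ _ _ i0 (fun i => 0 < dot (a i) d) F pos_i0) => i1 pos1 Fmin.
have slk1 : dot (a i1) x < b i1.
  by rewrite lt_neqAle Px andbT; apply/eqP => /tight e; rewrite e ltxx in pos1.
have hit1 : dot (a i1) (x + F i1 *: d) = b i1.
  by rewrite dotDr dotZr /F divfK ?gt_eqF//; ring.
have F1 : 0 < F i1 by rewrite divr_gt0// subr_gt0.
exists (F i1); split=> // [j|].
  rewrite dotDr dotZr -lerBrDl.
  have [pj|npj] := ltP 0 (dot (a j) d).
    by rewrite -ler_pdivlMr// Fmin.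
  by rewrite (@le_trans _ _ 0) ?subr_ge0// mulr_ge0_le0// ltW.
apply/proper_card/properP; split.
  apply/fintype.subsetP => j; rewrite !inE => lj; rewrite lt_neqAle Px andbT.
  apply/eqP => e; move: lj; rewrite dotDr dotZr (tight _ e) e mulr0 addr0.
  by rewrite ltxx.
by exists i1; rewrite !inE ?slk1// hit1 ltxx.
Qed.

(** A point that is not extreme lies inside a segment from y to y'. Leaving P in
    the two directions y - y' and y' - y ends at two points with fewer slack
    constraints, and x is a convex combination of these. *)
Lemma polytope_weights n (z : 'I_n -> 'rV[R]_m) :
  extreme_points P `<=` range z -> forall x, P x -> exists u, weight_vector z x u.
Proof.
move=> Pz x; have [k] := ubnP #|slack x|; elim: k x => // k IH x xk Px.
apply: contrapT => nW; have /Pz[i _ zi] : extreme_points P x.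
  split=> // y y' t Py Py' t01 xE; apply: contrapT => yy'; apply: nW.
  have /andP[t0 t1] := t01.
  have d0 : y - y' != 0 by rewrite subr_eq0; apply/eqP.
  (* A maximum of a linear form attained inside a segment is attained on all
     of it. *)
  have tight i : dot (a i) x = b i -> dot (a i) (y - y') = 0.
    move=> e; have : t * dot (a i) y + (1 - t) * dot (a i) y' = b i.
      by rewrite -e xE dotDr !dotZr.
    rewrite dotBr; have := Py i; have := Py' i => h1 h2 {}e.
    have e1 : dot (a i) y = b i by nra.
    have e2 : dot (a i) y' = b i by nra.
    by rewrite e1 e2 subrr.
  have [s [s0 Ps ls]] := polytope_face_exit Px d0 tight.
  have [||s' [s'0 Ps' ls']] := @polytope_face_exit x (- (y - y')) Px.
  - by rewrite oppr_eq0.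
  - by move=> i /tight e; rewrite dotNr e oppr0.
  have [u hu] := IH _ (leq_trans ls xk) Ps.
  have [u' hu'] := IH _ (leq_trans ls' xk) Ps'.
  pose r := s' / (s + s').
  have r01 : 0 <= r <= 1.
    have ss' : 0 < s + s' by exact: addr_gt0.
    by rewrite ler_pdivrMr// ltW ?divr_gt0//= mul1r lerDr ltW.
  have := weight_vector_conv r01 hu hu'.
  set w := (X in weight_vector z X _); have -> : w = x.
    have rE : r * s - (1 - r) * s' = 0.
      by rewrite /r; field; rewrite gt_eqF// addr_gt0.
    rewrite /w; move: (y - y') => d.
    rewrite !scalerDr !scalerN !scalerA addrACA -scalerDl subrKC scale1r.
    by rewrite -scalerBl rE scale0r addr0.
  by move=> ?; exists (r *: u + (1 - r) *: u').
by apply: nW; exists (delta_mx ord0 i); rewrite -zi; exact: weight_vector_vertex.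
Qed.

Lemma polytope_closed : closed P.
Proof.
rewrite [P](_ : _ = \bigcap_(i in setT) (dot (a i) @^-1` [set r | r <= b i])).
  apply: closed_bigI => i _; apply: (continuous_closedP _).1; last exact: closed_le.
  exact: dot_continuous_r.
by apply/seteqP; split=> [x Px i _|x Px i]; [exact: Px|exact: (Px i)].
Qed.

Lemma polytope_hull n (z : 'I_n -> 'rV[R]_m) x u : (forall i, P (z i)) ->
  weight_vector z x u -> P x.
Proof.
move=> Pz [-> su u0] k; rewrite dot_sumr -[leRHS]mul1r -su mulr_suml.
by apply: ler_sum => i _; rewrite ler_wpM2l//; exact: Pz.
Qed.

End Polytope.

(** * Calculus on compact convex sets *)

(** Heine-Cantor for a function that is continuous relatively to K only, by the
    near-covering form of compactness: around each x in K, the triangle inequality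
    through x gives one radius that works for all centres close to x. *)
Lemma compact_uniformly_continuous (R : realType) (V W : normedModType R)
    (K : set V) (f : V -> W) :
  compact K -> {within K, continuous f} -> forall e : R, 0 < e ->
  exists2 r, 0 < r &
    forall x y, K x -> K y -> `|x - y| < r -> `|f x - f y| < e.
Proof.
move=> /compact_near_coveringP cK /subspace_continuousP fK e e0.
pose P (r : R) x := forall y, K x -> K y -> `|x - y| < r -> `|f x - f y| < e.
have near_P x : K x -> \forall x' \near x & r \near (0 : R)^'+, P r x'.
  move=> Kx; have /cvgrPdist_lt/(_ _ (divr_gt0 e0 (ltr0n _ 2))) := fK x Kx.
  move=> /nbhs_ballP[s /= s0 fs].
  have fs' y : K y -> `|x - y| < s -> `|f x - f y| < e / 2.
    by move=> Ky xy; apply: fs => //; rewrite -ball_normE.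
  have s20 : 0 < s / 2 by rewrite divr_gt0.
  exists (ball x (s / 2), [set r | r < s / 2]) => /=.
    split; first exact: nbhsx_ballx.
    exact: nbhs_right_lt.
  move=> [x' r] /= [xx' rs] y Kx' Ky x'y; rewrite -ball_normE /= in xx'.
  have h1 : `|f x - f x'| < e / 2 by apply: fs' => //; lra.
  have h2 : `|f x - f y| < e / 2.
    by apply: fs' => //; have := ler_distD x' x y; lra.
  by have := ler_distD (f x) (f x') (f y); rewrite (distrC (f x') (f x)); lra.
have /cK KP := near_P; near (0 : R)^'+ => r.
have Pr : K `<=` P r by near: r.
by exists r => // x y Kx Ky; exact: Pr.
Unshelve. all: by end_near.
Qed.

Lemma compact_norm_bound (R : realType) (T : topologicalType)
    (W : normedModType R) (K : set T) (f : T -> W) :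
  compact K -> {within K, continuous f} ->
  exists2 M : R, 0 <= M & forall x, K x -> `|f x| <= M.
Proof.
move=> cK cf; have [M [_ Mb]] := compact_bounded (continuous_compact cf cK).
exists (`|M| + 1); first by rewrite addr_ge0.
by move=> x Kx; apply: Mb; [have := ler_norm M; lra|exists x].
Qed.

Section Calculus.
Variables (R : realType) (m : nat) (f : 'rV[R]_m -> R^o).

Lemma derive_gradient x d : differentiable f x ->
  'D_d f x = dot (gradient f x) d.
Proof.
move=> df; rewrite deriveE// {1}(row_sum_delta d) linear_sum /=.
by apply: eq_bigr => i _; rewrite linearZ /= mxE -deriveE// mulrC.
Qed.

(** The difference quotients of s |-> f (x + s d) at t are, term by term, those of
    f at x + t d in the direction d. *)
Lemma is_derive_along x d (t : R) : differentiable f (x + t *: d) ->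
  is_derive t 1 (fun s : R => f (x + s *: d) : R) (dot (gradient f (x + t *: d)) d).
Proof.
move=> df; have df' := @diff_derivable _ _ _ f _ d df.
have E : (fun h : R => h^-1 *: (((fun s : R => f (x + s *: d) : R) \o shift t) (h *: 1)
            - f (x + t *: d)))
       = (fun h : R => h^-1 *: ((f \o shift (x + t *: d)) (h *: d) - f (x + t *: d))).
  apply/funext => h /=; congr (_ *: (f _ - _)).
  by rewrite [h *: 1]mulr1 scalerDl addrCA.
split; first by rewrite /derivable E.
by rewrite -derive_gradient// /derive E.
Qed.

Lemma mean_value_segment x d (T : R) : 0 < T ->
  (forall t, 0 <= t <= T -> differentiable f (x + t *: d)) ->
  exists2 c, 0 < c < T &
    f (x + T *: d) - f x = T * dot (gradient f (x + c *: d)) d.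
Proof.
move=> T0 df.
have [t||c] := @MVT R (fun t => f (x + t *: d))
  (fun t => dot (gradient f (x + t *: d)) d) 0 T T0.
- rewrite in_itv /= => /andP[t0 tT]; apply: is_derive_along.
  by apply: df; rewrite !ltW.
- apply: derivable_within_continuous => {}t; rewrite in_itv /= => tT.
  by have [] := is_derive_along (df t tT).
- rewrite in_itv /= => cT; rewrite scale0r addr0 subr0 mulrC => E.
  by exists c.
Qed.

Variable D : set 'rV[R]_m.
Hypothesis D_convex : forall x y (t : R), D x -> D y -> 0 <= t <= 1 ->
  D (t *: x + (1 - t) *: y).
Hypothesis f_C1 : continuously_differentiable_on D f.

Lemma segment_in x d (T t : R) : D x -> D (x + T *: d) -> 0 <= t <= T ->
  D (x + t *: d).
Proof.
move=> Dx DT /andP[t0 tT]; have [T0|T0] := ltP 0 T; last first.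
  by (have -> : t = 0 by lra); rewrite scale0r addr0.
have -> : x + t *: d = (t / T) *: (x + T *: d) + (1 - t / T) *: x.
  rewrite scalerDr scalerA divfK ?gt_eqF// addrAC -scalerDl subrKC scale1r.
  by [].
by apply: D_convex => //; rewrite divr_ge0 ?(ltW T0)//= ler_pdivrMr// mul1r.
Qed.

(** The Armijo test succeeds for all short steps, uniformly in the base point and
    the direction: by the mean value theorem the increase of f is T times a slope
    at an intermediate point, and uniform continuity keeps that slope within
    (1 - beta) delta of the slope at x. *)
Lemma uniform_descent (C delta beta : R) : compact D ->
  0 <= C -> 0 < delta -> beta < 1 ->
  exists2 tau, 0 < tau & forall x d T, D x -> D (x + T *: d) ->
    `|d| <= C -> 0 < T <= tau -> dot (gradient f x) d <= - delta ->
    f (x + T *: d) <= f x + beta * T * dot (gradient f x) d.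
Proof.
move=> cD C0 delta0 beta1.
have mC0 : 0 < m%:R * C + 1 by rewrite ltr_wpDl// mulr_ge0.
(* With |d| <= C, a change of the gradient by less than e changes the slope by
   at most m e C <= (1 - beta) delta. *)
pose e := (1 - beta) * delta / (m%:R * C + 1).
have e0 : 0 < e by rewrite divr_gt0// mulr_gt0// subr_gt0.
have [r r0 fr] := compact_uniformly_continuous cD f_C1.2 e0.
have C10 : 0 < C + 1 by lra.
exists (r / (C + 1)); first by rewrite divr_gt0.
move=> x d T Dx DT dC /andP[T0 Tr] slope.
have [t t0T|c /andP[c0 cT] E] := @mean_value_segment x d T T0.
  by apply: f_C1.1; exact: segment_in DT t0T.
have Dc : D (x + c *: d) by apply: segment_in DT _ => //; rewrite !ltW.
have close : `|gradient f (x + c *: d) - gradient f x| < e.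
  apply: fr => //; rewrite addrAC subrr add0r normrZ gtr0_norm//.
  rewrite ler_pdivlMr// in Tr; apply: lt_le_trans Tr.
  by rewrite ltr_pM//; lra.
have : dot (gradient f (x + c *: d)) d - dot (gradient f x) d <= (1 - beta) * delta.
  rewrite -dotBl (le_trans (ler_norm _))// (le_trans (norm_dot_le _ _))//.
  apply: (@le_trans _ _ (e * (m%:R * C + 1))); last by rewrite divfK ?gt_eqF.
  rewrite [leLHS]mulrAC mulrC ler_pM ?mulr_ge0//; first exact: ltW.
  by rewrite (@le_trans _ _ (m%:R * C)) ?ler_wpM2l// lerDl.
move=> h.
have -> : f (x + T *: d) = f x + T * dot (gradient f (x + c *: d)) d.
  by rewrite -E; ring.
rewrite lerD2l [leRHS]mulrAC mulrC ler_pM2r//.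
nra.
Qed.

Lemma C1_continuous : {within D, continuous f}.
Proof.
apply/subspace_continuousP => x Dx; apply: cvg_within_filter.
exact: differentiable_continuous (f_C1.1 x Dx).
Qed.

(** Convexity bounds the difference quotients of f at x towards y by f y - f x,
    and the bound passes to the limit. *)
Lemma convex_gradient_le x y : convex_function D f -> D x -> D y ->
  f x + dot (gradient f x) (y - x) <= f y.
Proof.
move=> fconv Dx Dy.
have df := f_C1.1 x Dx.
rewrite -lerBrDl -derive_gradient//.
have /cvg_dnbhs_at_right quot := @diff_derivable _ _ _ f _ (y - x) df.
apply: cvgr_to_le quot _; near=> h => /=.
have h0 : 0 < h by [].
have h1 : h <= 1 by near: h; exact: nbhs_right_le.
have := fconv (Itv01 (ltW h0) h1) y x (mem_set Dy) (mem_set Dx).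
rewrite convRE /= => fh.
have -> : h *: (y - x) + x = h *: y + (1 - h) *: x.
  by rewrite scalerBr scalerBl scale1r addrA addrAC.
rewrite [leLHS](_ : _ = (f (h *: y + (1 - h) *: x) - f x) / h); last first.
  exact: mulrC.
rewrite ler_pdivrMr//.
have {}fh : f (h *: y + (1 - h) *: x) <= h * f y + (1 - h) * f x by [].
lra.
Unshelve. all: by end_near.
Qed.
End Calculus.

(** * Geometry of the feasible set *)

Section Method.
Variables (R : realType) (m n : nat) (D : set 'rV[R]_m) (z : 'I_n -> 'rV[R]_m).
Variables (f : 'rV[R]_m -> R^o) (p : PVM_params R).
Hypothesis D_hull : forall x, D x <-> exists u, weight_vector z x u.
Hypothesis D_compact : compact D.
Hypothesis f_C1 : continuously_differentiable_on D f.
Hypothesis p_adm : admissible_params p.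

Let delta_gt0 l : 0 < delta p l. Proof. by case: p_adm => _ _ []. Qed.
Let eps_gt0 l : 0 < eps p l. Proof. by case: p_adm => _ _ _ []. Qed.
Let beta_gt0 : 0 < beta p. Proof. by case: p_adm => /andP[]. Qed.
Let beta_lt1 : beta p < 1. Proof. by case: p_adm => /andP[]. Qed.
Let theta_gt0 : 0 < theta p. Proof. by case: p_adm => _ /andP[]. Qed.
Let theta_lt1 : theta p < 1. Proof. by case: p_adm => _ /andP[]. Qed.

Lemma hull_convex x y (t : R) : D x -> D y -> 0 <= t <= 1 ->
  D (t *: x + (1 - t) *: y).
Proof.
move=> /D_hull[u xu] /D_hull[v yv] t01; apply/D_hull.
by exists (t *: u + (1 - t) *: v); exact: weight_vector_conv.
Qed.

Lemma hull_vertex i : D (z i).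
Proof. by apply/D_hull; exists (delta_mx ord0 i); exact: weight_vector_vertex. Qed.

Lemma edges_bounded : exists2 C : R, 0 <= C & forall i j, `|z j - z i| <= C.
Proof.
have cont_id : {within D, continuous (@id 'rV[R]_m)}.
  by apply: continuous_subspaceT => x; exact: cvg_id.
have [M M0 Mb] := compact_norm_bound D_compact cont_id.
exists (M + M); first by rewrite addr_ge0.
by move=> i j; rewrite (le_trans (ler_normB _ _))// lerD// Mb//; exact: hull_vertex.
Qed.

Lemma slopes_bounded : exists2 G : R, 0 <= G &
  forall x i j, D x -> `|dot (gradient f x) (z i - z j)| <= G.
Proof.
have [C C0 Cb] := edges_bounded.
have [M M0 Mb] := compact_norm_bound D_compact f_C1.2.
exists (m%:R * M * C); first by rewrite !mulr_ge0.
move=> x i j Dx; rewrite (le_trans (norm_dot_le _ _))//.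
by rewrite ler_pM ?mulr_ge0// ler_wpM2l// Mb.
Qed.

(** * The line search *)

(** What Step 1 guarantees when it hands over to Step 2; the weights are no longer
    visible there, and feasibility of the full step g stands for g <= u_i. *)
Definition search_ready l x i j g :=
  [/\ D x, eps p l <= g, D (x + g *: (z j - z i))
    & delta p l <= dot (gradient f x) (z i - z j)].

Lemma trial_point_in l x i j g q : search_ready l x i j g ->
  D (x + (theta p ^+ q * g) *: (z j - z i)).
Proof.
move=> [Dx eg Dg _]; have g0 : 0 <= g by rewrite (le_trans _ eg)// ltW.
have th0 := ltW theta_gt0.
apply: (segment_in hull_convex Dx Dg); rewrite mulr_ge0 ?exprn_ge0//=.
by rewrite ler_piMl// exprn_ile1// ltW.
Qed.

Lemma short_step_descends l : exists2 tau, 0 < tau & forall x i j g q,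
  search_ready l x i j g -> theta p ^+ q * g <= tau ->
  sufficient_descent f p x (z j - z i) g q.
Proof.
have [C C0 Cb] := edges_bounded.
have [tau tau0 H] := uniform_descent hull_convex f_C1 D_compact C0 (delta_gt0 l) beta_lt1.
exists tau => // x i j g q ready short; have [Dx eg _ slope] := ready.
have g0 : 0 < g := lt_le_trans (eps_gt0 l) eg.
apply: H => //.
- exact: trial_point_in ready.
- by rewrite mulr_gt0// exprn_gt0.
- by rewrite -opprB dotNr lerN2.
Qed.

Lemma line_search_terminates l x i j g : search_ready l x i j g ->
  exists q, sufficient_descent f p x (z j - z i) g q.
Proof.
move=> ready; have [tau tau0 short] := short_step_descends l.
have [_ eg _ _] := ready; have g0 : 0 < g := lt_le_trans (eps_gt0 l) eg.
have : (fun q => theta p ^+ q) @ \oo --> (0 : R).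
  by apply: cvg_expr; rewrite gtr0_norm.
move=> /cvgr_le/(_ _ (divr_gt0 tau0 g0))[q _ small].
exists q; apply: short ready _; rewrite -ler_pdivlMr//.
exact: small q (leqnn q).
Qed.

(** The accepted step is either the full step g >= eps_l, or theta times a
    rejected step, which must have exceeded the threshold tau of
    [short_step_descends]. The Armijo test turns this lower bound on the step
    into a decrease of f that is the same for all iterations of stage l. *)
Lemma line_search_decrease l : exists2 c, 0 < c & forall x i j g q,
  search_ready l x i j g ->
  sufficient_descent f p x (z j - z i) g q ->
  (forall q', (q' < q)%N -> ~ sufficient_descent f p x (z j - z i) g q') ->
  f (x + (theta p ^+ q * g) *: (z j - z i)) <= f x - c.
Proof.
have [tau tau0 short] := short_step_descends l.
pose s := Num.min (eps p l) (theta p * tau).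
have s0 : 0 < s by rewrite lt_min eps_gt0 mulr_gt0.
exists (beta p * s * delta p l); first by rewrite !mulr_gt0.
move=> x i j g q ready descent first_q.
have [_ eg _ slope] := ready.
have long : s <= theta p ^+ q * g.
  case: q first_q {descent} => [_|q first_q].
    by rewrite expr0 mul1r (le_trans _ eg)// ge_min lexx.
  rewrite exprS -mulrA (@le_trans _ _ (theta p * tau)) ?ge_min ?lexx ?orbT//.
  rewrite ler_pM2l// leNgt; apply/negP => /ltW/(short _ _ _ _ _ ready).
  exact: first_q.
apply: le_trans descent _; rewrite lerD2l -[z j - z i]opprB dotNr mulrN lerN2.
apply: ler_pM => //; [by rewrite ltW ?mulr_gt0|exact: ltW|by rewrite ler_pM2l].
Qed.

(** * Invariants of the method *)

(** The condition under which stage l hands x over to the next stage. *)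
Definition stationary l x := exists2 u, weight_vector z x u &
  forall i j, ~ eligible_pair z f p l x u i j.

(** Invariant of the reachable states. Stage l starts from the result of stage
    l - 1, except that stage 1 starts from an arbitrary point; hence the
    condition 1 < l. *)
Definition valid (s : PVM_state R m n) : Prop :=
  match s with
  | Step0 l x => D x /\ ((1 < l)%N -> stationary l.-1 x)
  | Step1 _ _ x => D x
  | Step2 l _ x i j g => search_ready l x i j g
  end.

Definition state_point (s : PVM_state R m n) : 'rV[R]_m :=
  match s with
  | Step0 _ x => x
  | Step1 _ _ x => x
  | Step2 _ _ x _ _ _ => x
  end.

Definition searching l (s : PVM_state R m n) : bool :=
  if s is Step2 l' _ _ _ _ _ then l == l' else false.

(** Inversion of a transition by its source, with equations instead of the
    dependent indices. *)
Lemma PVM_next_inv s s' : PVM_next z f p s s' ->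
  match s with
  | Step0 l w => s' = Step1 l 0 w
  | Step1 l k x =>
      (exists u i j g, [/\ weight_vector z x u, eligible_pair z f p l x u i j,
         eps p l <= g <= u ord0 i & s' = Step2 l k x i j g]) \/
      (stationary l x /\ s' = Step0 l.+1 x)
  | Step2 l k x i j g => exists q,
      [/\ sufficient_descent f p x (z j - z i) g q,
         forall q', (q' < q)%N -> ~ sufficient_descent f p x (z j - z i) g q'
       & s' = Step1 l k.+1 (x + (theta p ^+ q * g) *: (z j - z i))]
  end.
Proof.
case=> [//|l k x u i j g xu elig gu|l k x u xu nelig|l k x i j g q desc first_q].
- by left; exists u, i, j, g.
- by right; split=> //; exists u.
- by exists q.
Qed.

Lemma valid_point s : valid s -> D (state_point s).
Proof. by case: s => [l x []|l k x|l k x i j g []]. Qed.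

Lemma valid_next s s' : PVM_next z f p s s' -> valid s -> valid s'.
Proof.
move=> /PVM_next_inv; case: s => [l x -> []//|l k x|l k x i j g] /=.
- case=> [[u [i [j [g [xu [_ slope] /andP[eg gu] ->]]]]]|[sx ->]] Dx //=.
  split=> //; apply/D_hull; exists (u + g *: (delta_mx ord0 j - delta_mx ord0 i)).
  by apply: weight_vector_shift => //; rewrite gu (le_trans _ eg)// ltW.
- by move=> [q [_ _ ->]] /trial_point_in; apply.
Qed.

(** In Step 1 the existence of weights is the convex hull property of D; Step 2
    needs the termination of the backtracking. *)
Lemma valid_progress s : valid s -> exists s', PVM_next z f p s s'.
Proof.
case: s => [l x _|l k x /D_hull[u xu]|l k x i j g /line_search_terminates desc].
- by exists (Step1 l 0 x); constructor.
- have [[i [j elig]]|none] := pselect (exists i j, eligible_pair z f p l x u i j).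
    exists (Step2 l k x i j (u ord0 i)); apply: (PVM_select k xu elig).
    by case: elig; rewrite inE lexx andbT.
  exists (Step0 l.+1 x); apply: PVM_restart xu _ => i j elig.
  by apply: none; exists i, j.
- have [q desc_q min_q] := ex_minnP desc.
  exists (Step1 l k.+1 (x + (theta p ^+ q * g) *: (z j - z i))).
  by constructor => // q' lt_q' /min_q; rewrite leqNgt lt_q'.
Qed.

Variable w0 : 'rV[R]_m.
Hypothesis w0_in_D : D w0.

Lemma valid_reachable s : PVM_reachable z f p w0 s -> valid s.
Proof. by elim=> {s} [|s s' _ vs next]; [split|exact: valid_next next vs]. Qed.

(** * Every stage is finite *)

Section Run.
Variable s : nat -> PVM_state R m n.
Hypothesis s_run : PVM_run z f p w0 s.

Lemma valid_run t : valid (s t).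
Proof.
elim: t => [|t IH]; first by rewrite s_run.1.
exact: valid_next (s_run.2 t) IH.
Qed.

(** Since the other stages do not increase f either, the iterations of stage l can
    be counted along the whole run, wherever they occur. *)
Lemma run_descent l : exists2 c, 0 < c & forall t,
  f (state_point (s t.+1)) <= f (state_point (s t)) - c * (searching l (s t))%:R.
Proof.
have [c c0 dec] := line_search_decrease l.
exists c => // t; have := valid_run t; have := PVM_next_inv (s_run.2 t).
case: (s t) => [l' x ->|l' k x|l' k x i j g] /=.
- by rewrite mulr0 subr0.
- by case=> [[u [i [j [g [_ _ _ ->]]]]]|[_ ->]] _; rewrite mulr0 subr0.
- move=> [q [desc first_q ->]] ready /=; case: eqP => [le|_]; last first.
    have [c' c'0 dec'] := line_search_decrease l'.
    by rewrite mulr0 subr0 (le_trans (dec' _ _ _ _ _ ready desc first_q))// gerBl ltW.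
  by rewrite mulr1; apply: dec => //; rewrite le.
Qed.

(** The number N T of iterations of stage l before time T is bounded, because each
    of them lowers f by c and f is bounded on D. From the time at which the
    nondecreasing N reaches its maximum, stage l iterates no more. *)
Lemma searching_eventually_stops l :
  exists T, forall t, (T <= t)%N -> ~~ searching l (s t).
Proof.
have [c c0 desc] := run_descent l.
have [M M0 Mb] := compact_norm_bound D_compact (C1_continuous f_C1).
pose N T := (\sum_(0 <= t < T) searching l (s t))%N.
have N_le T : c * (N T)%:R <= f w0 - f (state_point (s T)).
  elim: T => [|T IH]; first by rewrite /N big_nil mulr0 s_run.1 subrr.
  rewrite /N big_nat_recr//= natrD mulrDr -/(N T).
  by have := desc T; lra.
have N_bound T : (N T <= Num.bound ((M + M) / c))%N.
  rewrite -(ler_nat R) (le_trans _ (ltW (archi_boundP _)))//; last first.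
    by apply: divr_ge0; [exact: addr_ge0|exact: ltW].
  rewrite ler_pdivlMr// mulrC (le_trans (N_le T))//.
  have := Mb _ (valid_point (valid_run T)); have := Mb _ w0_in_D.
  by rewrite !ler_norml => /andP[? ?] /andP[? ?]; lra.
have exN : exists k, `[< exists T, N T = k >] by exists (N 0%N); apply/asboolP; exists 0%N.
have maxN k : `[< exists T, N T = k >] -> (k <= Num.bound ((M + M) / c))%N.
  by move=> /asboolP[T <-].
have [k /asboolP[T NT] kmax] := ex_maxnP exN maxN.
exists T => t Tt; apply/negP => st.
have : (N t.+1 <= k)%N by apply: kmax; apply/asboolP; exists t.+1.
rewrite /N big_nat_recr//= st addn1 ltnNge -NT => /negP; apply.
by rewrite /N (big_cat_nat (leq0n T) Tt)//= leq_addr.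
Qed.

Lemma k_changes_searching l t : k_changes s l t -> searching l (s t).
Proof. by move=> [k [x [i [j [g ->]]]]] /=. Qed.

Lemma k_changes_finite l : finite_set (k_changes s l).
Proof.
have [T Tstop] := searching_eventually_stops l.
apply: sub_finite_set (finite_II T) => t /k_changes_searching st /=.
by rewrite ltnNge; apply/negP => /Tstop; rewrite st.
Qed.

(** If stage l + 1 were never left, its states would alternate between Step 1 and
    Step 2, so that Step 2 would occur arbitrarily late. *)
Lemma run_generates : exists w, generates s w.
Proof.
suff H l : exists w, exists t, s t = Step0 l.+1 w.
  by have [w hw] := choice H; exists w.
elim: l => [|l [w [t0 st0]]]; first by exists w0, 0%N; exact: s_run.1.
apply: contrapT => never.
have [T Tstop] := searching_eventually_stops l.+1.
have cycle q : exists k x, s (t0 + q.*2).+1 = Step1 l.+1 k x.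
  elim: q => [|q [k [x sq]]].
    exists 0%N, w; have := PVM_next_inv (s_run.2 t0).
    by rewrite st0 addn0.
  have := PVM_next_inv (s_run.2 (t0 + q.*2).+1); rewrite sq.
  case=> [[u [i [j [g [_ _ _ s2]]]]]|[_ s2]]; last first.
    by exfalso; apply: never; exists x, (t0 + q.*2).+2.
  have := PVM_next_inv (s_run.2 (t0 + q.*2).+2); rewrite s2 => -[q' [_ _ s3]].
  by rewrite doubleS !addnS s3; do 2 eexists.
have [k [x sq]] := cycle T.
have := PVM_next_inv (s_run.2 (t0 + T.*2).+1); rewrite sq.
case=> [[u [i [j [g [_ _ _ s2]]]]]|[_ s2]].
  have /Tstop : (T <= (t0 + T.*2).+2)%N.
    by rewrite -addnn !leqW// addnA leq_addl.
  by rewrite s2 /= eqxx.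
by apply: never; exists x, (t0 + T.*2).+2.
Qed.

End Run.

(** * Limit points and optimality *)

(** Averaging over the weights of x first: a vertex with weight at least eps_l
    contributes at most u_i delta_l, any other vertex at most eps_l G. *)
Lemma stationary_gap : exists2 G : R, 0 <= G & forall l x y, D y ->
  stationary l x -> dot (gradient f x) (x - y) <= delta p l + G * eps p l.
Proof.
have [G G0 Gb] := slopes_bounded.
exists (n%:R * G) => [|l x y /D_hull[v yv] [u xu nelig]]; first exact: mulr_ge0.
have Dx : D x by apply/D_hull; exists u.
have vertex_gap j :
    dot (gradient f x) (x - z j) <= delta p l + n%:R * G * eps p l.
  rewrite (dot_weight_vector _ _ xu).
  have [_ su u0] := xu.
  have -> : delta p l + n%:R * G * eps p l =
      \sum_(i < n) (u ord0 i * delta p l + G * eps p l).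
    rewrite big_split -mulr_suml su sumr_const card_ord mul1r -mulrA.
    by rewrite mulr_natl.
  apply: ler_sum => i _.
  have [ui|ui] := leP (eps p l) (u ord0 i).
    apply: (@le_trans _ _ (u ord0 i * delta p l)).
      apply: ler_wpM2l => //; rewrite leNgt; apply/negP => /ltW slope.
      by apply: (nelig i j); split; rewrite ?inE.
    by rewrite lerDl mulr_ge0// ltW.
  apply: (@le_trans _ _ (G * eps p l)); last by rewrite lerDr mulr_ge0// ltW.
  rewrite mulrC (le_trans (ler_norm _))// normrM (ger0_norm (u0 i)).
  by rewrite ler_pM ?Gb// ltW.
rewrite -opprB dotNr (dot_weight_vector _ _ yv) -sumrN.
have [_ sv v0] := yv.
set B := (X in _ <= X).
have -> : B = \sum_(j < n) v ord0 j * B by rewrite -mulr_suml sv mul1r.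
by apply: ler_sum => j _; rewrite -mulrN -dotNr opprB ler_wpM2l.
Qed.

Lemma generated_in s w l : PVM_run z f p w0 s -> generates s w -> D (w l).
Proof.
by move=> run gen; have [t st] := gen l; have := valid_run run t; rewrite st => -[].
Qed.

Lemma generated_stationary s w l : PVM_run z f p w0 s -> generates s w ->
  (0 < l)%N -> stationary l (w l).
Proof.
move=> run gen l0; have [t st] := gen l; have := valid_run run t.
by rewrite st => -[_]; apply.
Qed.

Lemma generated_VI_gap : exists2 e : nat -> R, e @ \oo --> (0 : R) &
  forall s w l y, PVM_run z f p w0 s -> generates s w -> (0 < l)%N -> D y ->
    - e l <= dot (gradient f (w l)) (y - w l).
Proof.
have [G _ gap] := stationary_gap.
exists (fun l => delta p l + G * eps p l) => [|s w l y run gen l0 Dy].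
  have [_ _ [_ _ dl] [_ _ el] _] := p_adm.
  have -> : (0 : R) = 0 + G * 0 by rewrite mulr0 addr0.
  exact: cvgD dl (cvgMl_tmp el).
rewrite -opprB dotNr lerN2; apply: gap => //.
exact: generated_stationary gen l0.
Qed.

(** For fixed y in D, x' |-> <f'(x'), y - x'> is continuous on D and eventually at
    least -r/2 along the sequence, for every r > 0. *)
Lemma cluster_VI_solution s w x : PVM_run z f p w0 s -> generates s w ->
  cluster (w @ \oo) x -> VI_solution D (gradient f) x.
Proof.
move=> run gen wx; have [e e0 gap] := generated_VI_gap.
have Dw l : D (w l) := generated_in l run gen.
have clD : closed D := compact_closed (@norm_hausdorff _ _) D_compact.
have Dx : D x by apply: clD => B xB; apply: wx xB; exists 0%N => // l _; exact: Dw.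
split=> // y Dy; apply/ler_addgt0Pr => r r0.
have /subspace_continuousP/(_ x Dx) gx := f_C1.2.
have slope : dot (gradient f x') (y - x') @[x' --> within D (nbhs x)] -->
    dot (gradient f x) (y - x).
  apply: dot_cvg; first exact: gx.
  by apply: cvgB; [exact: cvg_cst|exact: cvg_within].
have r20 : 0 < r / 2 by rewrite divr_gt0.
have near_x : \forall x' \near x, D x' ->
    dot (gradient f x') (y - x') <= dot (gradient f x) (y - x) + r / 2.
  by apply: (cvgr_le _ slope); rewrite ltrDl.
have near_w : \forall x' \near w @ \oo,
    D x' /\ - (r / 2) <= dot (gradient f x') (y - x').
  rewrite near_map; near=> l; split=> //.
  apply: le_trans (gap s w l y run gen _ Dy); last by near: l; exists 1%N.
  by rewrite lerN2; near: l; exact: (cvgr_le _ e0).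
have [x' [[Dx' lo] /(_ Dx') hi]] := wx _ _ near_w near_x.
lra.
Unshelve. all: by end_near.
Qed.

(** The gradient inequality turns the gap into inf f <= f (w l) <= inf f + e l. *)
Lemma convex_values_cvg s w : convex_function D f ->
  PVM_run z f p w0 s -> generates s w -> (f \o w) @ \oo --> inf (f @` D).
Proof.
move=> fconv run gen; have [e e0 gap] := generated_VI_gap.
have Dw l : D (w l) := generated_in l run gen.
have [M _ Mb] := compact_norm_bound D_compact (C1_continuous f_C1).
have lbf : has_lbound (f @` D).
  by exists (- M) => _ [y Dy <-]; have := Mb _ Dy; rewrite ler_norml => /andP[].
have upper : (fun l => inf (f @` D) + e l) @ \oo --> inf (f @` D).
  by rewrite -[X in _ --> X]addr0; apply: cvgD => //; exact: cvg_cst.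
apply: squeeze_cvgr (@cvg_cst _ _ _ _ _) upper; near=> l; apply/andP; split.
  by apply: ge_inf => //; exists (w l).
rewrite -lerBlDr; apply: lb_le_inf; first by exists (f w0), w0.
move=> _ [y Dy <-]; have := convex_gradient_le f_C1 fconv (Dw l) Dy.
have : - e l <= dot (gradient f (w l)) (y - w l).
  by apply: gap run gen _ Dy; near: l; exists 1%N.
rewrite /=; lra.
Unshelve. all: by end_near.
Qed.

Lemma convex_VI_minimizer x : convex_function D f ->
  VI_solution D (gradient f) x -> minimizers D f x.
Proof.
move=> fconv [Dx VIx]; split=> // y Dy.
by have := convex_gradient_le f_C1 fconv Dx Dy; have := VIx _ Dy; lra.
Qed.

End Method.

(** * The theorem *)

Theorem theorem3p1 (R : realType) (m n : nat) (D : set 'rV[R]_m)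
    (z : 'I_n -> 'rV[R]_m) (f : 'rV[R]_m -> R^o)
    (p : PVM_params R) (w0 : 'rV[R]_m)
    (D_nonempty : D !=set0) (D_bounded : bounded_set D)
    (D_polyhedron : polyhedron D)
    (z_inj : injective z) (z_extreme : range z = extreme_points D)
    (f_C1 : continuously_differentiable_on D f)
    (p_admissible : admissible_params p) (w0_in_D : D w0) :
  ((forall s, PVM_reachable z f p w0 s -> exists s', PVM_next z f p s s') /\
   (forall s, PVM_run z f p w0 s ->
      (forall l, finite_set (k_changes s l)) /\ exists w, generates s w)) /\
  (forall s w, PVM_run z f p w0 s -> generates s w ->
     cluster (w @ \oo) !=set0 /\
     forall x, cluster (w @ \oo) x -> VI_solution D (gradient f) x) /\
  (convex_function D f ->
   forall s w, PVM_run z f p w0 s -> generates s w ->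
     (f \o w) @ \oo --> inf (f @` D) /\
     forall x, cluster (w @ \oo) x -> minimizers D f x).
Proof.
have [q [a [b DE]]] := D_polyhedron.
have Dz i : D (z i).
  by have [] : extreme_points D (z i) by (rewrite -z_extreme; exists i).
have D_hull x : D x <-> exists u, weight_vector z x u.
  split=> [Dx|[u]].
    rewrite DE in Dx; apply: polytope_weights Dx; rewrite -DE//.
    by rewrite z_extreme.
  by rewrite DE in Dz *; exact: polytope_hull.
have D_compact : compact D.
  by apply: bounded_closed_compact => //; rewrite DE; exact: polytope_closed.
split; [split=> [s /(valid_reachable D_hull p_admissible w0_in_D)|s run]|split].
- exact: valid_progress.
- split=> [l|]; first exact: k_changes_finite run l.
  exact: run_generates run.
- move=> s w run gen; split=> [|x]; last exact: cluster_VI_solution run gen.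
  have [|x [_ wx]] := D_compact (w @ \oo) _; last by exists x.
  by exists 0%N => // l _; exact: generated_in run gen.
- move=> fconv s w run gen; split; first exact: convex_values_cvg run gen.
  move=> x wx; apply: convex_VI_minimizer => //.
  exact: cluster_VI_solution run gen _.
Qed.
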